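(* Let $\tau\in\mathbb{C}$ with $\mathrm{Im}(\tau)>0$ and let $q=e^{\pi i\tau}$. For every complex number $z$, \[ \sin_q(3z)=\frac13\frac{\Pi_q}{\Pi_{q^9}}\sin_{q^9}z-\left(1+\frac13\frac{\Pi_q}{\Pi_{q^9}}\right)(\sin_{q^3}z)^3. \]
   Context: For $|q|<1$, $(a;q)_\infty=\prod_{i=0}^{\infty}(1-aq^i)$ and $(a,b;q)_\infty=(a;q)_\infty(b;q)_\infty$. With $q=e^{\pi i\tau}$, $\mathrm{Im}(\tau)>0$, complex powers of $q$ are understood as $q^a=e^{\pi i\tau a}$. Gosper's $q$-sine is the function defined by \[ \sin_q(\pi z)=q^{(z-1/2)^2}\frac{(q^{2z},q^{2-2z};q^2)_\infty}{(q;q^2)_\infty^2}\qquad(z\in\mathbb{C}), \] and \[ \Pi_q=q^{1/4}\frac{(q^2;q^2)_\infty^2}{(q;q^2)_\infty^2}. \] For a positive integer $m$, $\sin_{q^m}$ and $\Pi_{q^m}$ are the same expressions with $q$ replaced by $q^m=e^{\pi i m\tau}$ (that is, $\tau$ replaced by $m\tau$). *)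

(* Defs.v *)
From Stdlib Require Import Reals.
From Coquelicot Require Import Coquelicot.

Open Scope R_scope.
Open Scope C_scope.

Definition Cexp (z : C) : C :=
  (exp (Re z) * cos (Im z), exp (Re z) * sin (Im z))%R.

(** The product of the first [n] factors [f 0, ..., f (n - 1)]. *)
Fixpoint Cprod (f : nat -> C) (n : nat) : C :=
  match n with
  | O => 1
  | S k => Cprod f k * f k
  end.

(** [lim] is total; the value is meaningful only when the partial products
    converge (see [Cprod_inf_unique]), as they do for [qpoch_inf a q] when
    [Cmod q < 1]. *)
Definition Cprod_inf (f : nat -> C) : C :=
  lim (T := C_CompleteNormedModule) (filtermap (Cprod f) eventually).

Lemma Cprod_inf_unique (f : nat -> C) (l : C) :
  filterlim (Cprod f) eventually (locally l) -> Cprod_inf f = l.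
Proof.
intros H.
assert (PF : ProperFilter (filtermap (Cprod f) eventually)).
{ apply filtermap_proper_filter, eventually_filter. }
assert (Hlim : filterlim (Cprod f) eventually (locally (Cprod_inf f))).
{ apply filterlim_locally; intros eps.
  apply (complete_cauchy (T := C_CompleteNormedModule)
           (filtermap (Cprod f) eventually) PF).
  intros e; exists l.
  exact (proj1 (filterlim_locally (Cprod f) l) H e). }
exact (filterlim_locally_unique (Cprod f) _ _ Hlim H).
Qed.

Definition qpoch_inf (a q : C) : C := Cprod_inf (fun i => 1 - a * q ^ i).

(** The power [q ^ a] of [q = exp (PI * i * tau)], a complex power fixed by the
    choice of [tau] and not by that of [q] alone. This is why the functions
    below take [tau] as an argument, and why those attached to [q ^ m] are
    obtained by substituting [m * tau] for [tau]. *)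
Definition qpow (tau a : C) : C := Cexp (PI * Ci * tau * a).

Definition nome (tau : C) : C := Cexp (PI * Ci * tau).

(** Gosper's q-sine is defined by its value at [PI * z]; hence [z := w / PI]. *)
Definition qsin (tau w : C) : C :=
  let q := nome tau in
  let z := w / PI in
  qpow tau ((z - 1 / 2) ^ 2) *
  (qpoch_inf (qpow tau (2 * z)) (q ^ 2) *
   qpoch_inf (qpow tau (2 - 2 * z)) (q ^ 2)) /
  qpoch_inf q (q ^ 2) ^ 2.

Definition qPi (tau : C) : C :=
  let q := nome tau in
  qpow tau (1 / 4) *
  qpoch_inf (q ^ 2) (q ^ 2) ^ 2 / qpoch_inf q (q ^ 2) ^ 2.

(* Main.v *)
Require Import Defs.
From Stdlib Require Import Reals Lra Lia ZArith List Permutation Classical.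
From Coquelicot Require Import Coquelicot.
Import ListNotations.

Open Scope R_scope.
Open Scope C_scope.

(** Jacobi's theta function is hidden in the q-sine: up to an exponential
    factor and a constant, [qsin tau w] is [theta t a], where [theta t a] is the product
    [(x, p / x; p)] with [p = Cexp t], [x = Cexp a], and [p = q ^ 2], [x] a power
    of [q] ([qsin_theta]). The three q-sines of the identity use the bases
    [q ^ 2], [q ^ 6] and [q ^ 18], but all of them can be written in base
    [q ^ 6]. Splitting a product over residues modulo 3 turns the theta function
    in base [q ^ 2] into a product of three ([theta_trisect]), with arguments
    shifted by thirds of the quasi-period; factoring [1 - x ^ 3] by the cube roots
    of unity does the same for base [q ^ 18] ([theta_cube]), with arguments
    shifted by thirds of the period. So, with [t] for the exponent of [q ^ 2], the
    functions [sin_q (3 z)], [sin_(q^9) z] and [(sin_(q^3) z) ^ 3] are, up to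
    constants and a common factor that contains [theta (3 * t) a], the values of
    [h a b = theta (3 * t) (a + b) * theta (3 * t) (a - b)] at
    [b = t], [b = c] and [b = 0], where [Cexp c] is a primitive cube root of unity.

    As a function of two variables, [h] has rank two
    ([theta_product_rank_2]): Jacobi's triple product turns [h a b] into a double
    series, and the substitution of [m + n] and [m - n] for the two indices
    separates it, once for each parity, into a function of [a] times a function of
    [b]. Hence three columns of [h] are linearly dependent, and every 3 by 3
    determinant vanishes ([theta_determinant]).

    The coefficients of the dependence are read off from two further rows. At
    [a = 0] the value [h 0 0] vanishes and the ratio of [h 0 t] to [h 0 c] is a
    ratio of products [(q ^ m; q ^ m)] with [m = 2] and [m = 18], divided by 3: this
    gives the factor
    [1 / 3 * (qPi tau / qPi (9 * tau))], with no derivative being taken. At the half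
    period, that is [z = PI / 2], the three q-sines take the values -1, 1 and 1:
    this gives the remaining coefficient ([theta_product_relation]).

    Jacobi's triple product is itself the limit of a finite identity with Gaussian
    binomial coefficients ([jacobi_finite], [tannery]). All series are summed
    unconditionally over [Z] or [Z * Z], as limits along finite sets of indices. *)

(** * Limits of complex functions along a filter *)

(** Convergence measured by [Cmod] rather than by the balls of the uniform
    structure on [C], which are squares. *)
Definition tends {T : Type} (F : (T -> Prop) -> Prop) (f : T -> C) (l : C) : Prop :=
  forall eps : R, (0 < eps)%R -> F (fun x => (Cmod (f x - l) < eps)%R).

Lemma tends_filterlim {T : Type} (F : (T -> Prop) -> Prop) {FF : Filter F}
    (f : T -> C) (l : C) :
  tends F f l <-> filterlim f F (locally l).
Proof.
split.
- intros H. apply (filterlim_locally_ball_norm (U := C_NormedModule)). intros eps.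
  exact (H eps (cond_pos eps)).
- intros H eps Heps.
  exact (proj1 (filterlim_locally_ball_norm (U := C_NormedModule) f l) H (mkposreal eps Heps)).
Qed.

Lemma tends_unique {T : Type} (F : (T -> Prop) -> Prop) {FF : ProperFilter F}
    (f : T -> C) (l l' : C) :
  tends F f l -> tends F f l' -> l = l'.
Proof.
intros H H'.
exact (filterlim_locally_unique f l l' (proj1 (tends_filterlim F f l) H)
         (proj1 (tends_filterlim F f l') H')).
Qed.

Lemma tends_ext {T : Type} (F : (T -> Prop) -> Prop) {FF : Filter F}
    (f g : T -> C) (l : C) :
  F (fun x => f x = g x) -> tends F f l -> tends F g l.
Proof.
intros E H eps Heps. generalize (filter_and _ _ E (H eps Heps)).
apply filter_imp. intros x [<- Hx]. exact Hx.
Qed.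

Lemma tends_const {T : Type} (F : (T -> Prop) -> Prop) {FF : Filter F} (l : C) :
  tends F (fun _ => l) l.
Proof.
intros eps Heps. apply filter_forall. intros _.
replace (l - l) with (RtoC 0) by ring. rewrite Cmod_0. exact Heps.
Qed.

Lemma tends_plus {T : Type} (F : (T -> Prop) -> Prop) {FF : Filter F}
    (f g : T -> C) (l m : C) :
  tends F f l -> tends F g m -> tends F (fun x => f x + g x) (l + m).
Proof.
intros Hf Hg eps Heps.
assert (He : (0 < eps / 2)%R) by lra.
generalize (filter_and _ _ (Hf _ He) (Hg _ He)). apply filter_imp.
intros x [H1 H2].
replace (f x + g x - (l + m)) with ((f x - l) + (g x - m)) by ring.
eapply Rle_lt_trans. apply Cmod_triangle. lra.
Qed.

Lemma tends_mult {T : Type} (F : (T -> Prop) -> Prop) {FF : Filter F}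
    (f g : T -> C) (l m : C) :
  tends F f l -> tends F g m -> tends F (fun x => f x * g x) (l * m).
Proof.
intros Hf Hg eps Heps.
pose proof (Cmod_ge_0 l) as Hl. pose proof (Cmod_ge_0 m) as Hm.
set (d := Rmin 1 (eps / (Cmod l + Cmod m + 2))).
assert (Hq : (0 < eps / (Cmod l + Cmod m + 2))%R) by (apply Rdiv_lt_0_compat; lra).
assert (Hd : (0 < d)%R) by (apply Rmin_glb_lt; lra).
assert (Hd1 : (d <= 1)%R) by apply Rmin_l.
assert (Hd2 : (d * (Cmod l + Cmod m + 2) <= eps)%R).
{ apply Rle_trans with (eps / (Cmod l + Cmod m + 2) * (Cmod l + Cmod m + 2))%R.
  - apply Rmult_le_compat_r; [lra | apply Rmin_r].
  - right. field. lra. }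
generalize (filter_and _ _ (Hf _ Hd) (Hg _ Hd)). apply filter_imp.
intros x [H1 H2].
replace (f x * g x - l * m) with ((f x - l) * (g x - m) + (l * (g x - m) + (f x - l) * m))
  by ring.
pose proof (Cmod_ge_0 (f x - l)) as A1. pose proof (Cmod_ge_0 (g x - m)) as A2.
eapply Rle_lt_trans.
{ eapply Rle_trans; [apply Cmod_triangle|].
  apply Rplus_le_compat_l. apply Cmod_triangle. }
rewrite !Cmod_mult. nra.
Qed.

Lemma tends_scal {T : Type} (F : (T -> Prop) -> Prop) {FF : Filter F}
    (c : C) (f : T -> C) (l : C) :
  tends F f l -> tends F (fun x => c * f x) (c * l).
Proof.
intros H. apply tends_mult; [typeclasses eauto | now apply tends_const | exact H].
Qed.

Lemma tends_inv {T : Type} (F : (T -> Prop) -> Prop) {FF : Filter F}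
    (f : T -> C) (l : C) :
  l <> 0 -> tends F f l -> tends F (fun x => / f x) (/ l).
Proof.
intros Hl H eps Heps.
pose proof (Cmod_gt_0 l) as [Hl' _]. specialize (Hl' Hl).
set (d := Rmin (Cmod l / 2) (eps * (Cmod l * Cmod l / 2))).
assert (P : (0 < Cmod l * Cmod l / 2)%R) by nra.
assert (Hd : (0 < d)%R) by (apply Rmin_glb_lt; [lra | nra]).
generalize (H _ Hd). apply filter_imp. intros x Hx.
assert (H1 : (Cmod (f x - l) < Cmod l / 2)%R).
{ eapply Rlt_le_trans; [exact Hx | apply Rmin_l]. }
assert (H2 : (Cmod (f x - l) < eps * (Cmod l * Cmod l / 2))%R).
{ eapply Rlt_le_trans; [exact Hx | apply Rmin_r]. }
assert (H3 : (Cmod l / 2 < Cmod (f x))%R).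
{ pose proof (Cmod_triangle (f x) (- (f x - l))) as K.
  replace (f x + - (f x - l)) with l in K by ring. rewrite Cmod_opp in K. lra. }
assert (Hf : f x <> 0) by (intros E; rewrite E, Cmod_0 in H3; lra).
replace (/ f x - / l) with (- (f x - l) * / (f x * l)) by (field; split; assumption).
rewrite Cmod_mult, Cmod_opp, Cmod_inv, Cmod_mult by now apply Cmult_neq_0.
assert (H4 : (0 < Cmod (f x) * Cmod l)%R) by nra.
apply (Rmult_lt_reg_r (Cmod (f x) * Cmod l)); [exact H4|].
rewrite Rmult_assoc, Rinv_l, Rmult_1_r by lra.
eapply Rlt_le_trans; [exact H2|].
apply Rmult_le_compat_l; nra.
Qed.

Lemma tends_comp {S T : Type} (F : (S -> Prop) -> Prop) (G : (T -> Prop) -> Prop)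
    (f : T -> C) (g : S -> T) (l : C) :
  filterlim g F G -> tends G f l -> tends F (fun x => f (g x)) l.
Proof.
intros Hg Hf eps Heps. exact (Hg _ (Hf eps Heps)).
Qed.

Lemma tends_le {T : Type} (F : (T -> Prop) -> Prop) {FF : ProperFilter F}
    (f : T -> C) (l : C) (M : R) :
  F (fun x => (Cmod (f x) <= M)%R) -> tends F f l -> (Cmod l <= M)%R.
Proof.
intros B H. apply Rle_plus_epsilon. intros eps Heps.
destruct (filter_ex _ (filter_and _ _ B (H eps Heps))) as [x [H1 H2]].
pose proof (Cmod_triangle (f x) (- (f x - l))) as K.
replace (f x + - (f x - l)) with l in K by ring. rewrite Cmod_opp in K. lra.
Qed.

Lemma tends_cauchy {T : Type} (F : (T -> Prop) -> Prop) {FF : ProperFilter F} (f : T -> C) :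
  (forall eps : R, (0 < eps)%R -> exists l : C, F (fun x => (Cmod (f x - l) < eps)%R)) ->
  tends F f (lim (T := C_CompleteNormedModule) (filtermap f F)).
Proof.
intros H. apply tends_filterlim; [typeclasses eauto|].
apply filterlim_locally. intros eps.
apply (complete_cauchy (T := C_CompleteNormedModule) (filtermap f F)).
{ now apply filtermap_proper_filter. }
intros e. destruct (H e (cond_pos e)) as [l Hl]. exists l.
unfold filtermap. revert Hl. apply filter_imp. intros x Hx.
exact (norm_compat1 (V := C_NormedModule) l (f x) e Hx).
Qed.

(** * Unconditional summation *)

Definition Csum {I : Type} (f : I -> C) (L : list I) : C :=
  fold_right (fun i s => f i + s) 0 L.

Definition abs_sum {I : Type} (f : I -> C) (L : list I) : R :=
  fold_right (fun i s => (Cmod (f i) + s)%R) 0%R L.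

Lemma Csum_app {I : Type} (f : I -> C) (L L' : list I) :
  Csum f (L ++ L') = Csum f L + Csum f L'.
Proof. induction L as [|i L IH]; simpl; [ring | rewrite IH; ring]. Qed.

Lemma Csum_perm {I : Type} (f : I -> C) (L L' : list I) :
  Permutation L L' -> Csum f L = Csum f L'.
Proof. induction 1; simpl; try ring; congruence. Qed.

Lemma Csum_map {I J : Type} (f : J -> C) (u : I -> J) (L : list I) :
  Csum f (map u L) = Csum (fun i => f (u i)) L.
Proof. induction L as [|i L IH]; simpl; [easy | now rewrite IH]. Qed.

Lemma Csum_plus {I : Type} (f g : I -> C) (L : list I) :
  Csum (fun i => f i + g i) L = Csum f L + Csum g L.
Proof. induction L as [|i L IH]; simpl; [ring | rewrite IH; ring]. Qed.

Lemma Csum_scal {I : Type} (c : C) (f : I -> C) (L : list I) :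
  Csum (fun i => c * f i) L = c * Csum f L.
Proof. induction L as [|i L IH]; simpl; [ring | rewrite IH; ring]. Qed.

Lemma Csum_zero {I : Type} (f : I -> C) (L : list I) :
  (forall i, In i L -> f i = 0) -> Csum f L = 0.
Proof.
induction L as [|i L IH]; simpl; intros H; [easy|].
rewrite H, IH by auto. ring.
Qed.

Lemma Csum_prod {I J : Type} (f : I -> C) (g : J -> C) (A : list I) (B : list J) :
  Csum (fun k => f (fst k) * g (snd k)) (list_prod A B) = Csum f A * Csum g B.
Proof.
induction A as [|i A IH]; simpl; [ring|].
rewrite Csum_app, IH, Csum_map. simpl. rewrite Csum_scal. ring.
Qed.

Lemma NoDup_list_prod {I J : Type} (A : list I) (B : list J) :
  NoDup A -> NoDup B -> NoDup (list_prod A B).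
Proof.
intros NA NB. induction NA as [|i A Hi NA IH]; simpl; [constructor|].
apply NoDup_app.
- apply FinFun.Injective_map_NoDup; [|exact NB]. now intros j j' [= ->].
- exact IH.
- intros [i' j] H K. apply in_map_iff in H. destruct H as [j' [[= <- <-] _]].
  apply in_prod_iff in K. now destruct K.
Qed.

Lemma abs_sum_app {I : Type} (f : I -> C) (L L' : list I) :
  abs_sum f (L ++ L') = (abs_sum f L + abs_sum f L')%R.
Proof. induction L as [|i L IH]; simpl; [ring | rewrite IH; ring]. Qed.

Lemma abs_sum_perm {I : Type} (f : I -> C) (L L' : list I) :
  Permutation L L' -> abs_sum f L = abs_sum f L'.
Proof. induction 1; simpl; try ring; congruence. Qed.

Lemma abs_sum_map {I J : Type} (f : J -> C) (u : I -> J) (L : list I) :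
  abs_sum f (map u L) = abs_sum (fun i => f (u i)) L.
Proof. induction L as [|i L IH]; simpl; [easy | now rewrite IH]. Qed.

Lemma abs_sum_ge_0 {I : Type} (f : I -> C) (L : list I) : (0 <= abs_sum f L)%R.
Proof.
induction L as [|i L IH]; simpl; [lra|]. pose proof (Cmod_ge_0 (f i)). lra.
Qed.

Lemma abs_sum_prod {I J : Type} (f : I -> C) (g : J -> C) (A : list I) (B : list J) :
  abs_sum (fun k => f (fst k) * g (snd k)) (list_prod A B) = (abs_sum f A * abs_sum g B)%R.
Proof.
induction A as [|i A IH]; simpl; [ring|].
rewrite abs_sum_app, IH, abs_sum_map. simpl.
enough (E : abs_sum (fun j => f i * g j) B = (Cmod (f i) * abs_sum g B)%R) by (rewrite E; ring).
clear. induction B as [|j B IH]; simpl; [ring | rewrite IH, Cmod_mult; ring].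
Qed.

Lemma Cmod_Csum_le {I : Type} (f : I -> C) (L : list I) :
  (Cmod (Csum f L) <= abs_sum f L)%R.
Proof.
induction L as [|i L IH]; simpl; [rewrite Cmod_0; lra|].
eapply Rle_trans; [apply Cmod_triangle|]. lra.
Qed.

Lemma abs_sum_le {I : Type} (f g : I -> C) (K : R) (L : list I) :
  (forall i, Cmod (f i) <= K * Cmod (g i))%R -> (abs_sum f L <= K * abs_sum g L)%R.
Proof.
intros H. induction L as [|i L IH]; simpl; [lra|]. specialize (H i). lra.
Qed.

Lemma incl_Permutation {I : Type} (L L' : list I) :
  NoDup L -> incl L L' -> exists S, Permutation L' (L ++ S).
Proof.
intros N. revert L'. induction N as [|i L Hi N IH]; intros L' H.
- now exists L'.
- destruct (in_split i L') as [A [B E]]; [apply H; now left|].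
  destruct (IH (A ++ B)) as [R HR].
  + intros j Hj. assert (K : In j L') by (apply H; now right).
    rewrite E in K. apply in_app_iff in K. apply in_app_iff.
    destruct K as [K|[K|K]]; auto. subst j. contradiction.
  + exists R. rewrite E, <- Permutation_middle. simpl. now constructor.
Qed.

Lemma abs_sum_incl {I : Type} (f : I -> C) (L L' : list I) :
  NoDup L -> incl L L' -> (abs_sum f L <= abs_sum f L')%R.
Proof.
intros N H. destruct (incl_Permutation L L' N H) as [R HR].
rewrite (abs_sum_perm f _ _ HR), abs_sum_app. pose proof (abs_sum_ge_0 f R). lra.
Qed.

Lemma NoDup_same_elements {I : Type} (L : list I) :
  exists N, NoDup N /\ forall i, In i N <-> In i L.
Proof.
induction L as [|i L [N [H1 H2]]].
- exists []. split; [constructor | tauto].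
- destruct (classic (In i L)) as [K|K].
  + exists N. split; [exact H1|]. intros j. simpl. rewrite H2.
    intuition congruence.
  + exists (i :: N). split.
    * constructor; [now rewrite H2 | exact H1].
    * intros j. simpl. now rewrite H2.
Qed.

(** The finite subsets of [I], represented by duplicate-free lists and directed
    by inclusion. *)
Definition finite_sets (I : Type) (P : list I -> Prop) : Prop :=
  exists L, forall L', NoDup L' -> incl L L' -> P L'.

#[local] Instance finite_sets_proper (I : Type) : ProperFilter (finite_sets I).
Proof.
split.
- intros P [L H]. destruct (NoDup_same_elements L) as [N [H1 H2]].
  exists N. apply H; [exact H1|]. intros i. apply H2.
- split.
  + exists []. easy.
  + intros P Q [L H] [L' H']. exists (L ++ L'). intros M N Hi.
    split; [apply H | apply H']; auto; eapply incl_tran; try exact Hi.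
    * now apply incl_appl.
    * now apply incl_appr.
  + intros P Q HPQ [L H]. exists L. auto.
Qed.

(** Unconditional convergence. Its invariance under bijections and partitions of
    the index set replaces every rearrangement argument for double series. *)
Definition sums {I : Type} (f : I -> C) (s : C) : Prop :=
  tends (finite_sets I) (Csum f) s.

Definition tsum {I : Type} (f : I -> C) : C :=
  lim (T := C_CompleteNormedModule) (filtermap (Csum f) (finite_sets I)).

Lemma sums_unique {I : Type} (f : I -> C) (s s' : C) :
  sums f s -> sums f s' -> s = s'.
Proof. apply tends_unique. typeclasses eauto. Qed.

Lemma sums_ext {I : Type} (f g : I -> C) (s : C) :
  (forall i, f i = g i) -> sums f s -> sums g s.
Proof.
intros E. apply tends_ext; [typeclasses eauto|]. apply filter_forall.
intros L. induction L as [|i L IH]; simpl; [easy | now rewrite E, IH].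
Qed.

Lemma sums_plus {I : Type} (f g : I -> C) (s s' : C) :
  sums f s -> sums g s' -> sums (fun i => f i + g i) (s + s').
Proof.
intros H H'. eapply tends_ext; [typeclasses eauto | |].
2: { apply tends_plus; [typeclasses eauto | exact H | exact H']. }
apply filter_forall. intros L. symmetry. apply Csum_plus.
Qed.

Lemma sums_scal {I : Type} (c : C) (f : I -> C) (s : C) :
  sums f s -> sums (fun i => c * f i) (c * s).
Proof.
intros H. eapply tends_ext; [typeclasses eauto | |].
2: { apply tends_scal; [typeclasses eauto | exact H]. }
apply filter_forall. intros L. symmetry. apply Csum_scal.
Qed.

Lemma sums_reindex {I J : Type} (u : I -> J) (v : J -> I) (f : J -> C) (s : C) :
  (forall i, v (u i) = i) -> (forall j, u (v j) = j) ->
  sums f s -> sums (fun i => f (u i)) s.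
Proof.
intros Hvu Huv H eps Heps. destruct (H eps Heps) as [L HL].
exists (map v L). intros L' N Hi. rewrite <- Csum_map. apply HL.
- apply FinFun.Injective_map_NoDup; [|exact N].
  intros i i' E. rewrite <- (Hvu i), E. apply Hvu.
- intros j Hj. rewrite <- (Huv j). apply in_map, Hi, in_map, Hj.
Qed.

Lemma sums_single {I : Type} (f : I -> C) (i : I) :
  (forall j, j <> i -> f j = 0) -> sums f (f i).
Proof.
intros Z eps Heps. exists [i]. intros L N Hi.
destruct (incl_Permutation [i] L) as [R HR]; [repeat constructor; easy | exact Hi |].
rewrite (Csum_perm f _ _ HR). simpl. rewrite Csum_zero.
- replace (f i + 0 - f i) with (RtoC 0) by ring. now rewrite Cmod_0.
- intros j Hj. apply Z. intros ->.
  apply (Permutation_NoDup HR) in N. inversion N. contradiction.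
Qed.

Lemma Csum_cover {I J K : Type} (u : I -> K) (v : J -> K) (f : K -> C) (L : list K) :
  (forall k, (exists i, k = u i) \/ (exists j, k = v j)) ->
  (forall i j, u i <> v j) ->
  (forall i i', u i = u i' -> i = i') -> (forall j j', v j = v j' -> j = j') ->
  NoDup L ->
  exists A B, NoDup A /\ NoDup B /\
    (forall i, In (u i) L -> In i A) /\ (forall j, In (v j) L -> In j B) /\
    (forall i, In i A -> In (u i) L) /\ (forall j, In j B -> In (v j) L) /\
    Csum f L = Csum (fun i => f (u i)) A + Csum (fun j => f (v j)) B.
Proof.
intros Hc Hd Hu Hv N. induction N as [|k L Hk N [A [B [NA [NB [H1 [H2 [H3 [H4 E]]]]]]]]].
- exists [], []. simpl. repeat split; try constructor; try easy. ring.
- destruct (Hc k) as [[i ->]|[j ->]].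
  + exists (i :: A), B. repeat split; auto.
    * constructor; auto.
    * intros i' [K'|K']; [left; auto | right; auto].
    * intros j' [K'|K']; [now apply Hd in K' | auto].
    * intros i' [<-|K']; [now left | right; auto].
    * intros j' K'. right; auto.
    * simpl. rewrite E. ring.
  + exists A, (j :: B). repeat split; auto.
    * constructor; auto.
    * intros i' [K'|K']; [symmetry in K'; now apply Hd in K' | auto].
    * intros j' [K'|K']; [left; auto | right; auto].
    * intros i' K'. right; auto.
    * intros j' [<-|K']; [now left | right; auto].
    * simpl. rewrite E. ring.
Qed.

(** If [K] is the disjoint union of the images of two injections, its finite
    subsets are the unions of a finite subset of each piece. *)
Lemma sums_cover {I J K : Type} (u : I -> K) (v : J -> K) (f : K -> C) (s s' : C) :
  (forall k, (exists i, k = u i) \/ (exists j, k = v j)) ->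
  (forall i j, u i <> v j) ->
  (forall i i', u i = u i' -> i = i') -> (forall j j', v j = v j' -> j = j') ->
  sums (fun i => f (u i)) s -> sums (fun j => f (v j)) s' -> sums f (s + s').
Proof.
intros Hc Hd Hu Hv H H' eps Heps.
assert (He : (0 < eps / 2)%R) by lra.
destruct (H _ He) as [A HA]. destruct (H' _ He) as [B HB].
exists (map u A ++ map v B). intros L N Hi.
destruct (Csum_cover u v f L Hc Hd Hu Hv N) as [A' [B' [NA [NB [H1 [H2 [_ [_ E]]]]]]]].
rewrite E.
assert (K1 := HA A' NA). assert (K2 := HB B' NB).
replace (_ - _) with ((Csum (fun i => f (u i)) A' - s) + (Csum (fun j => f (v j)) B' - s'))
  by ring.
eapply Rle_lt_trans; [apply Cmod_triangle|].
enough (Cmod (Csum (fun i => f (u i)) A' - s) < eps / 2 /\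
        Cmod (Csum (fun j => f (v j)) B' - s') < eps / 2)%R by lra.
split.
- apply K1. intros i Ki. apply H1, Hi, in_app_iff. left. now apply in_map.
- apply K2. intros j Kj. apply H2, Hi, in_app_iff. right. now apply in_map.
Qed.

Definition abs_summable {I : Type} (f : I -> C) : Prop :=
  exists B : R, forall L, NoDup L -> (abs_sum f L <= B)%R.

Lemma abs_summable_le {I : Type} (f g : I -> C) (K : R) :
  (0 <= K)%R -> (forall i, Cmod (f i) <= K * Cmod (g i))%R ->
  abs_summable g -> abs_summable f.
Proof.
intros HK H [B HB]. exists (K * B)%R. intros L N.
eapply Rle_trans; [now apply (abs_sum_le f g K)|].
apply Rmult_le_compat_l; auto.
Qed.

(** The sums of absolute values have a least upper bound, and a finite set that
    nearly attains it leaves almost nothing for the rest. *)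
Lemma abs_summable_tail {I : Type} (f : I -> C) :
  abs_summable f -> forall eps : R, (0 < eps)%R ->
  exists L, NoDup L /\ forall R, NoDup (L ++ R) -> (abs_sum f R < eps)%R.
Proof.
intros [B HB] eps Heps.
destruct (completeness (fun x => exists L, NoDup L /\ x = abs_sum f L)) as [m [Hm1 Hm2]].
- exists B. intros x [L [N ->]]. auto.
- exists 0%R, []. split; [constructor | easy].
- destruct (classic (exists L, NoDup L /\ (m - eps < abs_sum f L)%R)) as [[L [N HL]]|K].
  + exists L. split; [exact N|]. intros R NR.
    assert (abs_sum f (L ++ R) <= m)%R by (apply Hm1; eauto).
    rewrite abs_sum_app in *. lra.
  + assert (m <= m - eps)%R; [|lra]. apply Hm2. intros x [L [N ->]].
    apply Rnot_lt_le. intros H. apply K. eauto.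
Qed.

Lemma abs_summable_sums {I : Type} (f : I -> C) :
  abs_summable f -> sums f (tsum f).
Proof.
intros H. apply tends_cauchy; [typeclasses eauto|]. intros eps Heps.
destruct (abs_summable_tail f H eps Heps) as [L [N HL]].
exists (Csum f L), L. intros L' N' Hi.
destruct (incl_Permutation L L' N Hi) as [R HR].
rewrite (Csum_perm f _ _ HR), Csum_app.
replace (_ - _) with (Csum f R) by ring.
eapply Rle_lt_trans; [apply Cmod_Csum_le|].
apply HL. now apply (Permutation_NoDup HR).
Qed.

Lemma abs_summable_prod {I J : Type} (f : I -> C) (g : J -> C) :
  abs_summable f -> abs_summable g ->
  abs_summable (fun k => f (fst k) * g (snd k)).
Proof.
intros [A HA] [B HB]. exists (A * B)%R. intros L N.
destruct (NoDup_same_elements (map fst L)) as [M [NM HM]].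
destruct (NoDup_same_elements (map snd L)) as [P [NP HP]].
eapply Rle_trans; [apply (abs_sum_incl _ L (list_prod M P) N)|].
- intros [i j] H. apply in_prod; [apply HM | apply HP].
  + exact (in_map fst _ _ H).
  + exact (in_map snd _ _ H).
- rewrite abs_sum_prod. apply Rmult_le_compat; auto using abs_sum_ge_0.
Qed.

(** The double family is absolutely summable, and its sum can be computed along
    boxes, which are cofinal among the finite subsets of the product. *)
Lemma sums_prod {I J : Type} (f : I -> C) (g : J -> C) :
  abs_summable f -> abs_summable g ->
  sums (fun k => f (fst k) * g (snd k)) (tsum f * tsum g).
Proof.
intros Hf Hg.
pose proof (abs_summable_sums _ (abs_summable_prod f g Hf Hg)) as H.
set (h := fun k : I * J => f (fst k) * g (snd k)) in *.
set (F := filter_prod (finite_sets I) (finite_sets J)).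
enough (E : tsum h = tsum f * tsum g) by now rewrite <- E.
apply (tends_unique F (fun M => Csum f (fst M) * Csum g (snd M))).
- intros eps Heps. destruct (H eps Heps) as [L HL].
  exists (fun A => NoDup A /\ incl (map fst L) A) (fun B => NoDup B /\ incl (map snd L) B).
  + exists (map fst L). auto.
  + exists (map snd L). auto.
  + intros A B [NA IA] [NB IB]. simpl. rewrite <- Csum_prod. apply HL.
    * now apply NoDup_list_prod.
    * intros [i j] K. apply in_prod; [apply IA | apply IB].
      -- exact (in_map fst _ _ K).
      -- exact (in_map snd _ _ K).
- apply tends_mult; [typeclasses eauto | |].
  + apply (tends_comp _ (finite_sets I) (Csum f) fst); [apply filterlim_fst|].
    now apply abs_summable_sums.
  + apply (tends_comp _ (finite_sets J) (Csum g) snd); [apply filterlim_snd|].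
    now apply abs_summable_sums.
Qed.

Lemma Csum_tends {I : Type} (c : nat -> I -> C) (d : I -> C) (L : list I) :
  (forall i, tends eventually (fun n => c n i) (d i)) ->
  tends eventually (fun n => Csum (c n) L) (Csum d L).
Proof.
intros H. induction L as [|i L IH]; simpl.
- apply tends_const. typeclasses eauto.
- apply tends_plus; auto. typeclasses eauto.
Qed.

(** Dominated convergence for sums: outside a fixed finite set the error is at
    most [2 * M] times a small tail of [a], and inside it the error tends to
    zero with [n]. *)
Lemma tannery {I : Type} (a : I -> C) (c : nat -> I -> C) (d : I -> C) (p : nat -> C)
    (q : C) (M : R) :
  (0 <= M)%R -> abs_summable a ->
  (forall n i, Cmod (c n i) <= M)%R ->
  (forall i, tends eventually (fun n => c n i) (d i)) ->
  (forall n, sums (fun i => c n i * a i) (p n)) ->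
  tends eventually p q ->
  sums (fun i => d i * a i) q.
Proof.
intros HM Ha Hc Hd Hp Hq.
assert (Hd' : forall i, (Cmod (d i) <= M)%R).
{ intros i. eapply tends_le; [ typeclasses eauto | | apply Hd]. now apply filter_forall. }
assert (Hda : abs_summable (fun i => d i * a i)).
{ apply (abs_summable_le _ a M); auto. intros i. rewrite Cmod_mult.
  apply Rmult_le_compat_r; auto using Cmod_ge_0. }
pose proof (abs_summable_sums _ Hda) as Hs.
set (s := tsum _) in *.
enough (E : q = s) by now rewrite E.
apply (tends_unique eventually p); [exact Hq|]. intros eps Heps.
set (e := (eps / (2 * (2 * M + 1)))%R).
assert (He : (0 < e)%R) by (apply Rdiv_lt_0_compat; lra).
destruct (abs_summable_tail a Ha e He) as [L [N HL]].
assert (K : tends eventually (fun n => Csum (fun i => (c n i + -1 * d i) * a i) L) 0).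
{ rewrite <- (Csum_zero (fun i => (d i + -1 * d i) * a i) L) by (intros; ring).
  apply Csum_tends. intros i.
  apply tends_mult; [typeclasses eauto | | apply tends_const; typeclasses eauto].
  apply tends_plus; [typeclasses eauto | apply Hd | apply tends_const; typeclasses eauto]. }
assert (He2 : (0 < eps / 2)%R) by lra.
generalize (K _ He2). apply filter_imp. intros n Kn.
set (g := fun i => (c n i + -1 * d i) * a i) in *.
replace (Csum g L - 0) with (Csum g L) in Kn by ring.
assert (Hg : sums g (p n - s)).
{ replace (p n - s) with (p n + -1 * s) by ring.
  apply (sums_ext (fun i => c n i * a i + -1 * (d i * a i))).
  - intros i. unfold g. ring.
  - apply sums_plus; [apply Hp | now apply sums_scal]. }
apply Rle_lt_trans with (Cmod (Csum g L) + 2 * M * e)%R.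
- apply (tends_le (finite_sets I) (Csum g)); [|exact Hg].
  exists L. intros L' N' Hi. destruct (incl_Permutation L L' N Hi) as [R HR].
  rewrite (Csum_perm g _ _ HR), Csum_app.
  eapply Rle_trans; [apply Cmod_triangle|]. apply Rplus_le_compat_l.
  eapply Rle_trans; [apply Cmod_Csum_le|].
  apply Rle_trans with (2 * M * abs_sum a R)%R.
  + apply abs_sum_le. intros i. unfold g. rewrite Cmod_mult.
    apply Rmult_le_compat_r; [apply Cmod_ge_0|].
    eapply Rle_trans; [apply Cmod_triangle|].
    replace (-1 * d i) with (- d i) by ring. rewrite Cmod_opp.
    specialize (Hc n i). specialize (Hd' i). lra.
  + apply Rmult_le_compat_l; [lra|]. apply Rlt_le, HL, (Permutation_NoDup HR N').
- enough (2 * M * e <= eps / 2)%R by lra.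
  replace (eps / 2)%R with ((2 * M + 1) * e)%R by (unfold e; field; lra). nra.
Qed.

(** * The complex exponential *)

Lemma Cmult_eq_reg_l (c x y : C) : c <> 0 -> c * x = c * y -> x = y.
Proof.
intros Hc E. replace x with (/ c * (c * x)) by (field; exact Hc).
rewrite E. field. exact Hc.
Qed.

Lemma Re_scal_lt_0 (x : R) (P : C) : (0 < x)%R -> (Re P < 0)%R -> (Re (x * P) < 0)%R.
Proof. intros Hx HP. rewrite re_scal_l. nra. Qed.

Lemma Cexp_plus (a b : C) : Cexp (a + b) = Cexp a * Cexp b.
Proof.
destruct a as [a1 a2], b as [b1 b2]. unfold Cexp, Cmult, Cplus, Re, Im. simpl.
rewrite exp_plus, cos_plus, sin_plus. f_equal; ring.
Qed.

Lemma Cexp_0 : Cexp 0 = 1.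
Proof.
unfold Cexp, Re, Im, RtoC. simpl. rewrite exp_0, cos_0, sin_0. f_equal; ring.
Qed.

Lemma Cexp_mult_opp (a : C) : Cexp a * Cexp (- a) = 1.
Proof. rewrite <- Cexp_plus, Cplus_opp_r. apply Cexp_0. Qed.

Lemma Cexp_neq_0 (a : C) : Cexp a <> 0.
Proof.
intros H. pose proof (Cexp_mult_opp a) as K. rewrite H, Cmult_0_l in K.
injection K. lra.
Qed.

Lemma Cexp_opp (a : C) : Cexp (- a) = / Cexp a.
Proof.
pose proof (Cexp_neq_0 a) as Ha.
replace (Cexp (- a)) with (Cexp a * Cexp (- a) * / Cexp a) by (field; exact Ha).
rewrite Cexp_mult_opp. ring.
Qed.

Lemma Cexp_pow (a : C) (n : nat) : Cexp a ^ n = Cexp (INR n * a).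
Proof.
induction n as [|n IH].
- simpl. rewrite Cmult_0_l. now rewrite Cexp_0.
- rewrite Cpow_S, IH, <- Cexp_plus, S_INR, RtoC_plus. f_equal. ring.
Qed.

Lemma Cmod_Cexp (a : C) : Cmod (Cexp a) = exp (Re a).
Proof.
unfold Cmod, Cexp. simpl.
replace (_ + _)%R with ((exp (Re a)) ^ 2 * (Rsqr (sin (Im a)) + Rsqr (cos (Im a))))%R
  by (unfold Rsqr; ring).
rewrite sin2_cos2, Rmult_1_r. apply sqrt_pow2, Rlt_le, exp_pos.
Qed.

Lemma Cexp_PI : Cexp (PI * Ci) = -1.
Proof.
unfold Cexp, Ci, Cmult, RtoC, Re, Im. simpl.
replace (PI * 0 - 0 * 1)%R with 0%R by ring.
replace (PI * 1 + 0 * 0)%R with PI by ring.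
rewrite exp_0, cos_PI, sin_PI. f_equal; ring.
Qed.

Lemma Cmod_Cexp_lt_1 (t : C) : (Re t < 0)%R -> (Cmod (Cexp t) < 1)%R.
Proof. intros H. rewrite Cmod_Cexp, <- exp_0. now apply exp_increasing. Qed.

Lemma cube_root_of_unity : exists c : C, Cexp c ^ 2 + Cexp c + 1 = 0.
Proof.
exists (2 * (PI / 3) * Ci). set (w := Cexp _).
assert (W3 : w ^ 3 = 1).
{ unfold w. rewrite Cexp_pow.
  replace (INR 3 * (2 * (PI / 3) * Ci)) with (PI * Ci + PI * Ci)
    by (simpl INR; rewrite !RtoC_plus; field).
  rewrite Cexp_plus, Cexp_PI. ring. }
assert (W1 : w - 1 <> 0).
{ intros E. apply (f_equal Re) in E. revert E. unfold w, Cexp.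
  replace (2 * (PI / 3) * Ci) with ((0, (2 * (PI / 3))%R) : C)
    by (unfold Cdiv; rewrite <- RtoC_inv by lra; unfold Ci, Cmult, RtoC; simpl; f_equal; field).
  unfold Re, Im. simpl. rewrite cos_2PI3, exp_0. lra. }
replace (w ^ 2 + w + 1) with ((w ^ 3 - 1) / (w - 1)) by (field; exact W1).
rewrite W3. unfold Cdiv. ring.
Qed.

Lemma Cexp_opp_cube_root (c : C) :
  Cexp c ^ 2 + Cexp c + 1 = 0 -> Cexp (- c) = Cexp c ^ 2.
Proof.
intros Hc. rewrite Cexp_opp.
assert (K : Cexp c ^ 3 = 1).
{ replace (Cexp c ^ 3) with (1 + (Cexp c - 1) * (Cexp c ^ 2 + Cexp c + 1)) by ring.
  rewrite Hc. ring. }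
replace (Cexp c ^ 2) with (Cexp c ^ 3 * / Cexp c) by (field; apply Cexp_neq_0).
rewrite K. ring.
Qed.

(** * q-Pochhammer symbols *)

Definition qpoch (a q : C) (n : nat) : C := Cprod (fun i => 1 - a * q ^ i) n.

Lemma qpoch_add (a q : C) (n m : nat) :
  qpoch a q (n + m) = qpoch a q n * qpoch (a * q ^ n) q m.
Proof.
induction m as [|m IH].
- rewrite Nat.add_0_r. unfold qpoch at 3. simpl. ring.
- rewrite Nat.add_succ_r. unfold qpoch in *. simpl.
  rewrite IH, Cpow_add_r. ring.
Qed.

(** The factors are controlled by [Cmod a * r ^ n] with [r = Cmod q]. Writing this
    as a difference of consecutive values of the geometric tail makes the next
    bounds telescope. *)
Lemma qpoch_Cmod_step (a q : C) (n : nat) :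
  (Cmod q < 1)%R ->
  (Cmod (a * q ^ n) = Cmod a / (1 - Cmod q) * (Cmod q ^ n - Cmod q ^ S n))%R.
Proof. intros Hq. rewrite Cmod_mult, Cmod_pow. simpl. field. lra. Qed.

Lemma qpoch_Cmod_le_exp (a q : C) (n : nat) :
  (Cmod q < 1)%R ->
  (Cmod (qpoch a q n) <= exp (Cmod a / (1 - Cmod q) * (1 - Cmod q ^ n)))%R.
Proof.
intros Hq. induction n as [|n IH].
- unfold qpoch. simpl. rewrite Cmod_1, Rminus_diag, Rmult_0_r, exp_0. lra.
- unfold qpoch in *. cbn [Cprod]. rewrite Cmod_mult.
  replace (Cmod a / (1 - Cmod q) * (1 - Cmod q ^ S n))%R
    with (Cmod a / (1 - Cmod q) * (1 - Cmod q ^ n) + Cmod (a * q ^ n))%R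
    by (rewrite qpoch_Cmod_step by exact Hq; ring).
  rewrite exp_plus. apply Rmult_le_compat; auto using Cmod_ge_0.
  eapply Rle_trans; [|apply exp_ineq1_le].
  unfold Cminus. eapply Rle_trans; [apply Cmod_triangle|].
  rewrite Cmod_1, Cmod_opp. lra.
Qed.

Lemma Rdiv_Cmod_ge_0 (a q : C) : (Cmod q < 1)%R -> (0 <= Cmod a / (1 - Cmod q))%R.
Proof.
intros Hq. apply Rmult_le_pos; [apply Cmod_ge_0|].
apply Rlt_le, Rinv_0_lt_compat. lra.
Qed.

Lemma qpoch_Cmod_le (a q : C) (n : nat) :
  (Cmod q < 1)%R ->
  (Cmod (qpoch a q n) <= exp (Cmod a / (1 - Cmod q)))%R.
Proof.
intros Hq. eapply Rle_trans; [now apply qpoch_Cmod_le_exp|].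
pose proof (Rdiv_Cmod_ge_0 a q Hq) as HA.
pose proof (pow_le (Cmod q) n (Cmod_ge_0 q)) as Hp.
destruct (Req_dec (Cmod q ^ n) 0) as [E|E].
- rewrite E. right. f_equal. ring.
- destruct HA as [HA|HA].
  + left. apply exp_increasing. nra.
  + rewrite <- HA. right. f_equal. ring.
Qed.

Lemma qpoch_near_1 (a q : C) (n : nat) :
  (Cmod q < 1)%R ->
  (Cmod (qpoch a q n - 1) <= exp (Cmod a / (1 - Cmod q)) * (Cmod a / (1 - Cmod q)))%R.
Proof.
intros Hq. pose proof (Rdiv_Cmod_ge_0 a q Hq) as HA.
apply Rle_trans with
  (exp (Cmod a / (1 - Cmod q)) * (Cmod a / (1 - Cmod q) * (1 - Cmod q ^ n)))%R.
- induction n as [|n IH].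
  + unfold qpoch. simpl. replace (1 - 1) with (RtoC 0) by ring. rewrite Cmod_0. lra.
  + assert (E : qpoch a q (S n) - 1 = (qpoch a q n - 1) + - (qpoch a q n * (a * q ^ n)))
      by (unfold qpoch; simpl; ring).
    rewrite E. eapply Rle_trans; [apply Cmod_triangle|].
    rewrite Cmod_opp, Cmod_mult, (qpoch_Cmod_step a q n Hq).
    pose proof (qpoch_Cmod_le a q n Hq) as K.
    assert (P : (0 <= Cmod a / (1 - Cmod q) * (Cmod q ^ n - Cmod q ^ S n))%R).
    { rewrite <- qpoch_Cmod_step by exact Hq. apply Cmod_ge_0. }
    pose proof (Rmult_le_compat_r _ _ _ P K). lra.
- apply Rmult_le_compat_l; [apply Rlt_le, exp_pos|].
  pose proof (pow_le (Cmod q) n (Cmod_ge_0 q)). nra.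
Qed.

Lemma exp_le_mono (x y : R) : (x <= y -> exp x <= exp y)%R.
Proof. intros [H| ->]; [left; now apply exp_increasing | lra]. Qed.

Lemma pow_small (r K eps : R) :
  (0 <= r < 1)%R -> (0 < eps)%R -> exists n, (K * r ^ n < eps)%R.
Proof.
intros Hr He. pose proof (Rabs_pos K) as HK.
destruct (pow_lt_1_zero r) with (y := (eps / (Rabs K + 1))%R) as [N HN].
- rewrite Rabs_pos_eq; lra.
- apply Rdiv_lt_0_compat; lra.
- exists N. specialize (HN N (le_n N)).
  pose proof (pow_le r N (proj1 Hr)) as Hp. rewrite Rabs_pos_eq in HN by exact Hp.
  assert (E : (eps = eps / (Rabs K + 1) * (Rabs K + 1))%R) by (field; lra).
  pose proof (Rle_abs K). nra.
Qed.

(** Cauchy, because [qpoch a q (n + k)] is [qpoch a q n] times a product whose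
    parameter [a * q ^ n] is small, hence a product close to 1. *)
Lemma qpoch_tends (a q : C) :
  (Cmod q < 1)%R -> tends eventually (qpoch a q) (qpoch_inf a q).
Proof.
intros Hq. pose proof (Rdiv_Cmod_ge_0 a q Hq) as HA.
pose proof (Cmod_ge_0 q) as Hq0.
apply tends_cauchy; [typeclasses eauto|]. intros eps Heps.
set (A := (Cmod a / (1 - Cmod q))%R) in *.
destruct (pow_small (Cmod q) (exp A * (exp A * A)) eps) as [n Hn]; [lra | exact Heps |].
exists (qpoch a q n), n. intros m Hm.
replace m with (n + (m - n))%nat by lia. change (Cprod _ ?k) with (qpoch a q k).
rewrite qpoch_add.
replace (_ - _) with (qpoch a q n * (qpoch (a * q ^ n) q (m - n) - 1)) by ring.
rewrite Cmod_mult. eapply Rle_lt_trans; [|exact Hn].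
pose proof (pow_le (Cmod q) n Hq0) as Hp.
assert (Hp1 : (Cmod q ^ n <= 1)%R).
{ rewrite <- (pow1 n). apply pow_incr. lra. }
pose proof (qpoch_near_1 (a * q ^ n) q (m - n) Hq) as K.
assert (EA : (Cmod (a * q ^ n) / (1 - Cmod q) = A * Cmod q ^ n)%R).
{ rewrite Cmod_mult, Cmod_pow. unfold A. field. lra. }
rewrite EA in K.
assert (K2 : (exp (A * Cmod q ^ n) <= exp A)%R) by (apply exp_le_mono; nra).
rewrite Rmult_assoc.
apply Rmult_le_compat; auto using Cmod_ge_0.
- now apply qpoch_Cmod_le.
- eapply Rle_trans; [exact K|]. rewrite Rmult_assoc.
  apply Rmult_le_compat_r; [nra | exact K2].
Qed.

Lemma qpoch_inf_split (a q : C) (n : nat) :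
  (Cmod q < 1)%R -> qpoch_inf a q = qpoch a q n * qpoch_inf (a * q ^ n) q.
Proof.
intros Hq.
apply (tends_unique eventually (fun m => qpoch a q (n + m))).
- apply (tends_comp eventually eventually (qpoch a q) (fun m => (n + m)%nat)).
  + intros P [N HN]. exists N. intros m Hm. apply HN. lia.
  + now apply qpoch_tends.
- apply (tends_ext eventually (fun m => qpoch a q n * qpoch (a * q ^ n) q m)).
  + apply filter_forall. intros m. now rewrite qpoch_add.
  + apply tends_scal; [typeclasses eauto | now apply qpoch_tends].
Qed.

Lemma qpoch_inf_shift (a q : C) :
  (Cmod q < 1)%R -> qpoch_inf a q = (1 - a) * qpoch_inf (a * q) q.
Proof.
intros Hq. rewrite (qpoch_inf_split a q 1 Hq). unfold qpoch. simpl.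
rewrite !Cmult_1_r. f_equal; try ring.
Qed.

(** After finitely many nonzero factors are removed, what remains is within 3/4
    of 1. *)
Lemma qpoch_inf_neq_0 (a q : C) :
  (Cmod q < 1)%R -> (forall i, a * q ^ i <> 1) -> qpoch_inf a q <> 0.
Proof.
intros Hq Ha. pose proof (Cmod_ge_0 q) as Hq0.
destruct (pow_small (Cmod q) (Cmod a / (1 - Cmod q)) (1 / 4)) as [n Hn]; [lra | lra |].
rewrite (qpoch_inf_split a q n Hq). apply Cmult_neq_0.
- clear Hn. unfold qpoch. induction n as [|n IH]; simpl.
  + intros E. injection E. lra.
  + apply Cmult_neq_0; [exact IH|]. intros E. apply (Ha n).
    replace (a * q ^ n) with (1 - (1 - a * q ^ n)) by ring. rewrite E. ring.
- set (b := a * q ^ n).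
  assert (Hb : (Cmod b / (1 - Cmod q) < 1 / 4)%R).
  { unfold b. rewrite Cmod_mult, Cmod_pow.
    replace (_ / _)%R with (Cmod a / (1 - Cmod q) * Cmod q ^ n)%R by (field; lra).
    exact Hn. }
  intros E.
  assert (K : (Cmod (qpoch_inf b q + - (1)) <= 3 / 4)%R).
  { apply (tends_le eventually (fun m => qpoch b q m + - (1))).
    - apply filter_forall. intros m.
      eapply Rle_trans; [apply (qpoch_near_1 b q m Hq)|].
      pose proof (Rdiv_Cmod_ge_0 b q Hq) as HA.
      set (B := (Cmod b / (1 - Cmod q))%R) in *.
      assert (exp B <= 3)%R.
      { eapply Rle_trans; [apply exp_le_mono | apply exp_le_3]. lra. }
      pose proof (exp_pos B). nra.
    - apply tends_plus; [typeclasses eauto | now apply qpoch_tends |].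
      apply tends_const. typeclasses eauto. }
  rewrite E, Cplus_0_l, Cmod_opp, Cmod_1 in K. lra.
Qed.

Lemma Cmod_pow_lt_1 (q : C) (n : nat) : (Cmod q < 1)%R -> (Cmod (q ^ S n) < 1)%R.
Proof.
intros Hq. rewrite Cmod_pow. pose proof (Cmod_ge_0 q) as H0.
assert (Cmod q ^ n <= 1)%R by (rewrite <- (pow1 n); apply pow_incr; lra).
pose proof (pow_le (Cmod q) n H0). simpl. nra.
Qed.

Lemma qpoch_inf_neq_0_lt_1 (a q : C) (Ha : (Cmod a < 1)%R) (Hq : (Cmod q < 1)%R) :
  qpoch_inf a q <> 0.
Proof.
apply qpoch_inf_neq_0; [exact Hq|]. intros i E.
assert (K : (Cmod (a * q ^ i) < 1)%R); [|rewrite E, Cmod_1 in K; lra].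
rewrite Cmod_mult, Cmod_pow. pose proof (Cmod_ge_0 q). pose proof (Cmod_ge_0 a).
assert (Cmod q ^ i <= 1)%R by (rewrite <- (pow1 i); apply pow_incr; lra).
pose proof (pow_le (Cmod q) i). nra.
Qed.

Lemma qpoch_inf_trisect (a q : C) :
  (Cmod q < 1)%R ->
  qpoch_inf a q =
    qpoch_inf a (q ^ 3) * qpoch_inf (a * q) (q ^ 3) * qpoch_inf (a * q ^ 2) (q ^ 3).
Proof.
intros Hq. pose proof (Cmod_pow_lt_1 q 2 Hq) as Hq3.
apply (tends_unique eventually (fun n => qpoch a q (3 * n))).
- apply (tends_comp eventually eventually (qpoch a q) (fun m => (3 * m)%nat)).
  + intros P [N HN]. exists N. intros m Hm. apply HN. lia.
  + now apply qpoch_tends.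
- apply (tends_ext eventually (fun n => qpoch a (q ^ 3) n * qpoch (a * q) (q ^ 3) n
                                        * qpoch (a * q ^ 2) (q ^ 3) n)).
  + apply filter_forall. intros n. unfold qpoch. induction n as [|n IH]; [simpl; ring|].
    replace (3 * S n)%nat with (S (S (S (3 * n)))) by lia.
    cbn [Cprod]. rewrite <- IH, <- !Cpow_mult_r, !Cpow_S. ring.
  + apply tends_mult; [typeclasses eauto | apply tends_mult; [typeclasses eauto| |] |];
      now apply qpoch_tends.
Qed.

Lemma qpoch_inf_cube (a q w : C) :
  (Cmod q < 1)%R -> w ^ 2 + w + 1 = 0 ->
  qpoch_inf (a ^ 3) (q ^ 3) =
    qpoch_inf a q * qpoch_inf (a * w) q * qpoch_inf (a * w ^ 2) q.
Proof.
intros Hq Hw. pose proof (Cmod_pow_lt_1 q 2 Hq) as Hq3.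
apply (tends_unique eventually (qpoch (a ^ 3) (q ^ 3))).
- now apply qpoch_tends.
- apply (tends_ext eventually (fun n => qpoch a q n * qpoch (a * w) q n
                                        * qpoch (a * w ^ 2) q n)).
  + apply filter_forall. intros n. unfold qpoch. induction n as [|n IH]; [simpl; ring|].
    cbn [Cprod]. rewrite <- IH.
    assert (F : (1 - a * q ^ n) * (1 - a * w * q ^ n) * (1 - a * w ^ 2 * q ^ n) =
            1 - a ^ 3 * (q ^ 3) ^ n).
    { replace ((q ^ 3) ^ n) with ((q ^ n) ^ 3) by (rewrite <- !Cpow_mult_r; f_equal; lia).
      set (x := q ^ n).
      transitivity (1 - a ^ 3 * x ^ 3
        - (w ^ 2 + w + 1) * (a * x - (a * x) ^ 2 * w + (a * x) ^ 3 * (w - 1))); [ring|].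
      rewrite Hw. ring. }
    rewrite <- F. ring.
  + apply tends_mult; [typeclasses eauto | apply tends_mult; [typeclasses eauto| |] |];
      now apply qpoch_tends.
Qed.

(** * Jacobi's triple product *)

Lemma abs_summable_geom (x : R) :
  (0 <= x < 1)%R -> abs_summable (fun k : Z => RtoC (x ^ Z.abs_nat k)).
Proof.
intros Hx. exists (2 / (1 - x))%R. intros L N.
set (f := fun k : Z => RtoC (x ^ Z.abs_nat k)).
assert (G : forall (u : nat -> Z) n, (forall i, Z.abs_nat (u i) = i) ->
          (abs_sum f (map u (seq 0 n)) <= 1 / (1 - x))%R).
{ intros u n Hu. rewrite abs_sum_map.
  assert (E : (abs_sum (fun i => f (u i)) (seq 0 n) = (1 - x ^ n) / (1 - x))%R).
  { induction n as [|n IH]; [simpl; field; lra|].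
    rewrite seq_S, abs_sum_app, IH. simpl. unfold f. rewrite Hu, Cmod_R, Rabs_pos_eq.
    - field. lra.
    - apply pow_le. lra. }
  rewrite E. apply Rmult_le_compat_r.
  - apply Rlt_le, Rinv_0_lt_compat. lra.
  - pose proof (pow_le x n (proj1 Hx)). lra. }
set (n := S (list_max (map Z.abs_nat L))).
apply Rle_trans with
  (abs_sum f (map Z.of_nat (seq 0 n) ++ map (fun i => - Z.of_nat i)%Z (seq 0 n))).
- apply abs_sum_incl; [exact N|]. intros k Hk. apply in_app_iff.
  assert (B : (Z.abs_nat k < n)%nat).
  { apply Nat.lt_succ_r.
    apply (proj1 (Forall_forall _ _) (proj1 (list_max_le (map Z.abs_nat L) _) (le_n _))).
    now apply in_map. }
  destruct (Z_le_gt_dec 0 k); [left | right];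
    apply in_map_iff; exists (Z.abs_nat k); (split; [lia | apply in_seq; lia]).
- rewrite abs_sum_app.
  assert (G1 := G Z.of_nat n Zabs2Nat.id).
  assert (G2 := G (fun i => - Z.of_nat i)%Z n ltac:(intros i; lia)). lra.
Qed.

(** Completing the square in the exponent gives a bound by a multiple of
    [exp (- |k|)]. *)
Lemma abs_summable_gauss (s b : C) :
  (Re s < 0)%R -> abs_summable (fun k : Z => Cexp (s * IZR k ^ 2 + b * IZR k)).
Proof.
intros Hs. set (c := (- Re s)%R). set (be := (Rabs (Re b) + 1)%R).
apply (abs_summable_le _ (fun k : Z => RtoC (exp (-1) ^ Z.abs_nat k))
         (exp (be ^ 2 / (4 * c)))).
- apply Rlt_le, exp_pos.
- intros k. rewrite Cmod_Cexp, Cmod_R, Rabs_pos_eq by apply pow_le, Rlt_le, exp_pos.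
  assert (E : (exp (-1) ^ Z.abs_nat k = exp (- Rabs (IZR k)))%R).
  { replace (Rabs (IZR k)) with (INR (Z.abs_nat k))
      by now rewrite INR_IZR_INZ, Zabs2Nat.id_abs, abs_IZR.
    generalize (Z.abs_nat k). intros n. induction n as [|n IH].
    - simpl. now rewrite Ropp_0, exp_0.
    - rewrite S_INR. simpl. rewrite IH, <- exp_plus. f_equal. ring. }
  rewrite E, <- exp_plus. apply exp_le_mono.
  replace (Re (s * IZR k ^ 2 + b * IZR k)) with (- c * IZR k ^ 2 + Re b * IZR k)%R
    by (unfold c; destruct s, b; unfold Re; simpl; ring).
  set (x := IZR k).
  assert (H1 : (Re b * x <= Rabs (Re b) * Rabs x)%R)
    by (rewrite <- Rabs_mult; apply Rle_abs).
  assert (H2 : (x ^ 2 = Rabs x ^ 2)%R) by now rewrite pow2_abs.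
  assert (H3 : (be ^ 2 / (4 * c) = c * (Rabs x - be / (2 * c)) ^ 2
                + be * Rabs x - c * Rabs x ^ 2)%R) by (field; unfold c; lra).
  assert (H4 : (0 <= c * (Rabs x - be / (2 * c)) ^ 2)%R)
    by (apply Rmult_le_pos; [unfold c; lra | apply pow2_ge_0]).
  rewrite H3, H2. unfold be in *. lra.
- apply abs_summable_geom. split; [apply Rlt_le, exp_pos|].
  rewrite <- exp_0. apply exp_increasing. lra.
Qed.

(** The term [(-1) ^ k * p ^ (k * (k - 1) / 2) * x ^ k] of Jacobi's series with
    [p = Cexp t] and [x = Cexp a]; the sign is absorbed into the exponent. *)
Definition jacobi_term (t a : C) (k : Z) : C :=
  Cexp (t * (IZR k * (IZR k - 1) / 2) + (a + PI * Ci) * IZR k).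

Lemma abs_summable_jacobi_term (t a : C) : (Re t < 0)%R -> abs_summable (jacobi_term t a).
Proof.
intros Ht.
assert (Ht2 : (Re (t / 2) < 0)%R).
{ unfold Cdiv. rewrite <- RtoC_inv, re_scal_r by lra. lra. }
apply (abs_summable_le _ _ 1 Rle_0_1) with
  (2 := abs_summable_gauss (t / 2) (a + PI * Ci - t / 2) Ht2).
intros k. rewrite Rmult_1_l. right. unfold jacobi_term. do 2 f_equal. field.
Qed.

(** The value 0 at negative integers makes [inv_qpoch_pred] hold for every integer,
    so that the recurrence below needs no boundary cases. *)
Definition inv_qpoch (t : C) (j : Z) : C :=
  if (j <? 0)%Z then 0 else / qpoch (Cexp t) (Cexp t) (Z.to_nat j).

Lemma qpoch_self_neq_0 (t : C) (n : nat) :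
  (Re t < 0)%R -> qpoch (Cexp t) (Cexp t) n <> 0.
Proof.
intros Ht E. apply Cmod_Cexp_lt_1 in Ht.
apply (qpoch_inf_neq_0_lt_1 (Cexp t) (Cexp t) Ht Ht).
rewrite (qpoch_inf_split _ _ n Ht), E. ring.
Qed.

Lemma inv_qpoch_pred (t : C) (j : Z) :
  (Re t < 0)%R -> inv_qpoch t (j - 1) = (1 - Cexp (t * IZR j)) * inv_qpoch t j.
Proof.
intros Ht. unfold inv_qpoch.
destruct (Z.ltb_spec (j - 1) 0); destruct (Z.ltb_spec j 0); try lia.
- ring.
- replace j with 0%Z by lia. rewrite Cmult_0_r, Cexp_0. ring.
- set (n := Z.to_nat (j - 1)).
  assert (En : Z.to_nat j = S n) by lia. rewrite En.
  assert (F := qpoch_self_neq_0 t (S n) Ht).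
  assert (Ej : Cexp (t * IZR j) = Cexp t * Cexp t ^ n).
  { rewrite <- Cpow_S, Cexp_pow. f_equal.
    replace j with (Z.of_nat (S n)) by lia. rewrite <- INR_IZR_INZ. ring. }
  rewrite Ej. unfold qpoch in *. cbn [Cprod] in *.
  field. split; intros E; apply F; rewrite E; ring.
Qed.

(** The Gaussian binomial coefficient of [2 * N] over [N + k] in the base
    [Cexp t]. *)
Definition jacobi_coef (t : C) (N : nat) (k : Z) : C :=
  qpoch (Cexp t) (Cexp t) (2 * N) *
  (inv_qpoch t (Z.of_nat N + k) * inv_qpoch t (Z.of_nat N - k)).

(** Everything is a multiple of the two reciprocals at [N + 1 + k] and
    [N + 1 - k]; what remains is a polynomial identity in [X], [Y] and [p]. *)
Lemma jacobi_coef_succ (t : C) (N : nat) (k : Z) :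
  (Re t < 0)%R ->
  jacobi_coef t (S N) k =
    (1 + Cexp (t * (2 * INR N + 1))) * jacobi_coef t N k
    + Cexp (t * (INR N + 1 - IZR k)) * jacobi_coef t N (k - 1)
    + Cexp (t * (INR N + 1 + IZR k)) * jacobi_coef t N (k + 1).
Proof.
intros Ht. unfold jacobi_coef.
set (n := Z.of_nat N).
replace (Z.of_nat (S N)) with (n + 1)%Z by lia.
set (R := inv_qpoch t (n + 1 + k)). set (T := inv_qpoch t (n + 1 - k)).
pose (p := Cexp t).
pose (X := Cexp (t * (INR N + IZR k))). pose (Y := Cexp (t * (INR N - IZR k))).
assert (EN : INR N = IZR n) by apply INR_IZR_INZ.
assert (R1 : inv_qpoch t (n + k) = (1 - p * X) * R).
{ replace (n + k)%Z with (n + 1 + k - 1)%Z by ring. rewrite inv_qpoch_pred by exact Ht.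
  unfold R, p, X. rewrite <- Cexp_plus. do 3 f_equal.
  rewrite !plus_IZR, !RtoC_plus, EN. ring. }
assert (R2 : inv_qpoch t (n + (k - 1)) = (1 - X) * inv_qpoch t (n + k)).
{ replace (n + (k - 1))%Z with (n + k - 1)%Z by ring. rewrite inv_qpoch_pred by exact Ht.
  unfold X. do 3 f_equal. rewrite plus_IZR, RtoC_plus, EN. ring. }
assert (T1 : inv_qpoch t (n - k) = (1 - p * Y) * T).
{ replace (n - k)%Z with (n + 1 - k - 1)%Z by ring. rewrite inv_qpoch_pred by exact Ht.
  unfold T, p, Y. rewrite <- Cexp_plus. do 3 f_equal.
  rewrite minus_IZR, plus_IZR, RtoC_minus, !RtoC_plus, EN. ring. }
assert (T2 : inv_qpoch t (n - (k + 1)) = (1 - Y) * inv_qpoch t (n - k)).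
{ replace (n - (k + 1))%Z with (n - k - 1)%Z by ring. rewrite inv_qpoch_pred by exact Ht.
  unfold Y. do 3 f_equal. rewrite minus_IZR, RtoC_minus, EN. ring. }
replace (n - (k - 1))%Z with (n + 1 - k)%Z by ring.
replace (n + (k + 1))%Z with (n + 1 + k)%Z by ring.
fold R T. rewrite R2, T2, R1, T1.
replace (Cexp (t * (2 * INR N + 1))) with (p * (X * Y))
  by (unfold p, X, Y; rewrite <- !Cexp_plus; f_equal; ring).
replace (Cexp (t * (INR N + 1 - IZR k))) with (p * Y)
  by (unfold p, Y; rewrite <- !Cexp_plus; f_equal; ring).
replace (Cexp (t * (INR N + 1 + IZR k))) with (p * X)
  by (unfold p, X; rewrite <- !Cexp_plus; f_equal; ring).
replace (2 * S N)%nat with (S (S (2 * N))) by lia.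
unfold qpoch. cbn [Cprod]. fold p.
assert (P2 : p ^ (2 * N) = X * Y).
{ unfold p, X, Y. rewrite Cexp_pow, <- Cexp_plus. f_equal.
  rewrite mult_INR, RtoC_mult. simpl INR. rewrite RtoC_plus. ring. }
rewrite Cpow_S, P2. ring.
Qed.

(** Induction on [N]: the two new factors multiply to a combination of 1 and two
    monomials, and multiplication by a monomial shifts the index of the series.
    Since the coefficients vanish for [|k| > N], the sum is finite. *)
Lemma jacobi_finite (t a : C) (N : nat) :
  (Re t < 0)%R ->
  sums (fun k => jacobi_coef t N k * jacobi_term t a k)
    (qpoch (Cexp a) (Cexp t) N * qpoch (Cexp (t - a)) (Cexp t) N).
Proof.
intros Ht. induction N as [|N IH].
- assert (E : jacobi_coef t 0 0 * jacobi_term t a 0 = 1 * 1).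
  { unfold jacobi_coef, jacobi_term, inv_qpoch, qpoch. simpl.
    replace (t * _ + _) with (RtoC 0) by (field).
    rewrite Cexp_0. field. }
  unfold qpoch. simpl. rewrite <- E. apply (sums_single (fun k => jacobi_coef t 0 k * jacobi_term t a k)).
  intros k Hk. unfold jacobi_coef, inv_qpoch.
  destruct (Z.ltb_spec (Z.of_nat 0 + k) 0); destruct (Z.ltb_spec (Z.of_nat 0 - k) 0);
    try lia; ring.
- set (P := _ * _) in IH.
  pose (u := - (Cexp a * Cexp (t * INR N))).
  pose (v := - (Cexp (t - a) * Cexp (t * INR N))).
  assert (EP : qpoch (Cexp a) (Cexp t) (S N) * qpoch (Cexp (t - a)) (Cexp t) (S N)
               = (1 + Cexp (t * (2 * INR N + 1))) * P + u * P + v * P).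
  { unfold qpoch in *. cbn [Cprod]. fold P.
    assert (Ep : Cexp t ^ N = Cexp (t * INR N)) by (rewrite Cexp_pow; f_equal; ring).
    rewrite Ep. replace (Cexp (t * (2 * INR N + 1))) with (u * v).
    - unfold P, u, v. ring.
    - unfold u, v. replace (- _ * - _)
        with ((Cexp a * Cexp (t * INR N)) * (Cexp (t - a) * Cexp (t * INR N))) by ring.
      rewrite <- !Cexp_plus. f_equal. ring. }
  rewrite EP.
  apply (sums_ext (fun k => (1 + Cexp (t * (2 * INR N + 1))) * (jacobi_coef t N k * jacobi_term t a k)
     + u * (jacobi_coef t N (k - 1) * jacobi_term t a (k - 1))
     + v * (jacobi_coef t N (k + 1) * jacobi_term t a (k + 1)))).
  + intros k. rewrite jacobi_coef_succ by exact Ht.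
    assert (Eu : u * jacobi_term t a (k - 1) = Cexp (t * (INR N + 1 - IZR k)) * jacobi_term t a k).
    { unfold u, jacobi_term. replace (- _) with (Cexp (PI * Ci) * (Cexp a * Cexp (t * INR N)))
        by (rewrite Cexp_PI; ring).
      rewrite <- !Cexp_plus. f_equal. rewrite minus_IZR, RtoC_minus.
      field. }
    assert (Ev : v * jacobi_term t a (k + 1) = Cexp (t * (INR N + 1 + IZR k)) * jacobi_term t a k).
    { unfold v, jacobi_term.
      replace (- _) with (/ Cexp (PI * Ci) * (Cexp (t - a) * Cexp (t * INR N)))
        by (rewrite Cexp_PI; field).
      rewrite <- Cexp_opp, <- !Cexp_plus. f_equal. rewrite plus_IZR, RtoC_plus.
      field. }
    replace (u * (jacobi_coef t N (k - 1) * jacobi_term t a (k - 1)))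
      with (jacobi_coef t N (k - 1) * (u * jacobi_term t a (k - 1))) by ring.
    replace (v * (jacobi_coef t N (k + 1) * jacobi_term t a (k + 1)))
      with (jacobi_coef t N (k + 1) * (v * jacobi_term t a (k + 1))) by ring.
    rewrite Eu, Ev. ring.
  + apply sums_plus; [apply sums_plus|]; apply sums_scal.
    * exact IH.
    * apply (sums_reindex (fun k => k - 1)%Z (fun k => k + 1)%Z
               (fun k => jacobi_coef t N k * jacobi_term t a k));
        [intros; ring | intros; ring | exact IH].
    * apply (sums_reindex (fun k => k + 1)%Z (fun k => k - 1)%Z
               (fun k => jacobi_coef t N k * jacobi_term t a k));
        [intros; ring | intros; ring | exact IH].
Qed.

Lemma tends_bounded (f : nat -> C) (l : C) :
  tends eventually f l -> exists M, forall n, (Cmod (f n) <= M)%R.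
Proof.
intros H. destruct (filterlim_bounded (V := C_NormedModule) f) as [M HM].
- exists l. now apply (tends_filterlim eventually f l).
- exists M. exact HM.
Qed.

(** The modified theta function [(x, p / x; p)] of [x = Cexp a], [p = Cexp t]. *)
Definition theta (t a : C) : C :=
  qpoch_inf (Cexp a) (Cexp t) * qpoch_inf (Cexp (t - a)) (Cexp t).

(** The limit of [jacobi_finite]: each coefficient tends to
    [1 / (p; p)], and they are uniformly bounded, so [tannery] applies. *)
Lemma jacobi_triple_product (t a : C) :
  (Re t < 0)%R ->
  sums (jacobi_term t a) (qpoch_inf (Cexp t) (Cexp t) * theta t a).
Proof.
intros Ht. pose proof (Cmod_Cexp_lt_1 t Ht) as Hp. set (p := Cexp t) in *.
pose proof (qpoch_inf_neq_0_lt_1 p p Hp Hp) as Hnz. set (Q := qpoch_inf p p) in *.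
pose proof (qpoch_tends p p Hp) as HQ. fold Q in HQ.
assert (HQ' : tends eventually (fun n => / qpoch p p n) (/ Q)).
{ apply tends_inv; auto. typeclasses eauto. }
destruct (tends_bounded _ _ HQ) as [M1 HM1]. destruct (tends_bounded _ _ HQ') as [M2 HM2].
assert (P1 : (0 <= M1)%R) by (eapply Rle_trans; [apply Cmod_ge_0 | apply (HM1 O)]).
assert (P2 : (0 <= M2)%R) by (eapply Rle_trans; [apply Cmod_ge_0 | apply (HM2 O)]).
assert (HR : forall j, (Cmod (inv_qpoch t j) <= M2)%R).
{ intros j. unfold inv_qpoch. destruct (j <? 0)%Z; [rewrite Cmod_0; exact P2 | apply HM2]. }
assert (HRl : forall k, tends eventually (fun N => inv_qpoch t (Z.of_nat N + k)) (/ Q)).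
{ intros k. apply (tends_ext eventually (fun N => / qpoch p p (Z.to_nat (Z.of_nat N + k)))).
  - exists (Z.to_nat (- k)). intros N HN. unfold inv_qpoch.
    destruct (Z.ltb_spec (Z.of_nat N + k) 0); [lia | easy].
  - apply (tends_comp eventually eventually (fun n => / qpoch p p n)
             (fun N => Z.to_nat (Z.of_nat N + k))); [|exact HQ'].
    intros P [N0 HN0]. exists (N0 + Z.to_nat (- k))%nat. intros N HN. apply HN0. lia. }
replace (Q * theta t a) with (/ / Q * theta t a) by (field; exact Hnz).
apply (sums_ext (fun k => / / Q * (/ Q * jacobi_term t a k))).
{ intros k. field. exact Hnz. }
apply sums_scal.
apply (tannery (jacobi_term t a) (fun N => jacobi_coef t N) (fun _ => / Q)
  (fun N => qpoch (Cexp a) p N * qpoch (Cexp (t - a)) p N) _ (M1 * (M2 * M2))).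
- apply Rmult_le_pos; [exact P1 | nra].
- now apply abs_summable_jacobi_term.
- intros N k. unfold jacobi_coef. rewrite !Cmod_mult.
  apply Rmult_le_compat; try apply Cmod_ge_0.
  + apply Rmult_le_pos; apply Cmod_ge_0.
  + apply HM1.
  + apply Rmult_le_compat; auto using Cmod_ge_0.
- intros k. replace (/ Q) with (Q * (/ Q * / Q)) by (field; exact Hnz).
  unfold jacobi_coef. apply tends_mult; [typeclasses eauto | | apply tends_mult; [typeclasses eauto| |]].
  + apply (tends_comp eventually eventually (qpoch p p) (fun N => (2 * N)%nat)); [|exact HQ].
    intros P [N0 HN0]. exists N0. intros N HN. apply HN0. lia.
  + apply HRl.
  + apply (HRl (- k)%Z).
- intros N. now apply jacobi_finite.
- apply tends_mult; [typeclasses eauto | |]; now apply qpoch_tends.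
Qed.

(** * The rank of a product of two theta functions *)

(** By [jacobi_triple_product] the left side is a double series over pairs
    [(m, n)] whose exponent is quadratic in [m + n] and [m - n] separately. These
    two integers have the same parity: [(m, n)] is [(k + l, k - l)] or
    [(k + l + 1, k - l)], and on each of the two classes the series is a product
    of a series in [a] and a series in [b]. *)
Lemma theta_product_rank_2 (t : C) :
  (Re t < 0)%R ->
  exists A B A' B' : C -> C, forall a b,
    theta t (a + b) * theta t (a - b) = A a * B b + A' a * B' b.
Proof.
intros Ht. pose proof (Cmod_Cexp_lt_1 t Ht) as Hp.
pose proof (qpoch_inf_neq_0_lt_1 _ _ Hp Hp) as Hnz.
set (Q := qpoch_inf (Cexp t) (Cexp t)) in *.
set (gauss := fun (b : C) (k : Z) => Cexp (t * IZR k ^ 2 + b * IZR k)).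
assert (Hg : forall b, abs_summable (gauss b)) by (intros b; now apply abs_summable_gauss).
exists (fun a => / Q ^ 2 * tsum (gauss (2 * (a + PI * Ci) - t))), (fun b => tsum (gauss (2 * b))),
  (fun a => / Q ^ 2 * (Cexp (a + PI * Ci) * tsum (gauss (2 * (a + PI * Ci))))),
  (fun b => Cexp b * tsum (gauss (2 * b + t))).
intros a b.
assert (J : forall x, tsum (jacobi_term t x) = Q * theta t x).
{ intros x. apply (sums_unique (jacobi_term t x)).
  - apply abs_summable_sums. now apply abs_summable_jacobi_term.
  - now apply jacobi_triple_product. }
pose (w := a + PI * Ci).
assert (E : (Q * theta t (a + b)) * (Q * theta t (a - b)) =
  tsum (gauss (2 * w - t)) * tsum (gauss (2 * b)) +
  Cexp (w + b) * (tsum (gauss (2 * w)) * tsum (gauss (2 * b + t)))).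
{ rewrite <- !J.
  apply (sums_unique (fun k => jacobi_term t (a + b) (fst k) * jacobi_term t (a - b) (snd k))).
  { apply sums_prod; now apply abs_summable_jacobi_term. }
  apply (sums_cover (fun k => (fst k + snd k, fst k - snd k)%Z)
                    (fun k => (fst k + snd k + 1, fst k - snd k)%Z)).
  - intros [m n]. destruct (Zeven_odd_dec (m + n)) as [H|H].
    + apply Zeven_div2 in H. left.
      exists (Z.div2 (m + n), Z.div2 (m + n) - n)%Z. simpl. f_equal; lia.
    + apply Zodd_div2 in H. right.
      exists (Z.div2 (m + n), Z.div2 (m + n) - n)%Z. simpl. f_equal; lia.
  - intros [k l] [k' l'] [= H1 H2]. simpl in *. lia.
  - intros [k l] [k' l'] [= H1 H2]. simpl in *. f_equal; lia.
  - intros [k l] [k' l'] [= H1 H2]. simpl in *. f_equal; lia.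
  - eapply sums_ext; [|apply (sums_prod (gauss (2 * w - t)) (gauss (2 * b))); apply Hg].
    intros [k l]. simpl. unfold gauss, jacobi_term. rewrite <- !Cexp_plus. f_equal.
    rewrite plus_IZR, minus_IZR, RtoC_plus, RtoC_minus. unfold w. field.
  - apply (sums_ext (fun k => Cexp (w + b) * (gauss (2 * w) (fst k) * gauss (2 * b + t) (snd k)))).
    + intros [k l]. simpl. unfold gauss, jacobi_term. rewrite <- !Cexp_plus. f_equal.
      rewrite !plus_IZR, minus_IZR, !RtoC_plus, RtoC_minus. unfold w. field.
    + apply sums_scal, sums_prod; apply Hg. }
rewrite Cexp_plus in E. fold w.
replace (theta t (a + b) * theta t (a - b))
  with (/ Q ^ 2 * ((Q * theta t (a + b)) * (Q * theta t (a - b)))) by (field; exact Hnz).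
rewrite E. ring.
Qed.

(** A 3 by 3 matrix of rank at most 2 is singular. This is a form of
    Weierstrass's three-term identity for theta functions. *)
Lemma theta_determinant (t a1 a2 a3 b1 b2 b3 : C) :
  (Re t < 0)%R ->
  let h a b := theta t (a + b) * theta t (a - b) in
  h a1 b1 * (h a2 b2 * h a3 b3 - h a2 b3 * h a3 b2)
  - h a1 b2 * (h a2 b1 * h a3 b3 - h a2 b3 * h a3 b1)
  + h a1 b3 * (h a2 b1 * h a3 b2 - h a2 b2 * h a3 b1) = 0.
Proof.
intros Ht h. destruct (theta_product_rank_2 t Ht) as [A [B [A' [B' H]]]].
unfold h. rewrite !H. ring.
Qed.

(** * Theta functions in the bases q^2, q^6 and q^18 *)

Lemma theta_sym (t a : C) : theta t (t - a) = theta t a.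
Proof.
unfold theta. replace (t - (t - a)) with a by ring. ring.
Qed.

Lemma theta_0 (t : C) : (Re t < 0)%R -> theta t 0 = 0.
Proof.
intros Ht. unfold theta. rewrite Cexp_0, qpoch_inf_shift by now apply Cmod_Cexp_lt_1.
ring.
Qed.

Lemma theta_shift (t a : C) :
  (Re t < 0)%R -> theta t (a + t) = - Cexp (- a) * theta t a.
Proof.
intros Ht. pose proof (Cmod_Cexp_lt_1 t Ht) as Hp. unfold theta.
replace (t - (a + t)) with (- a) by ring.
rewrite (qpoch_inf_shift (Cexp a)), (qpoch_inf_shift (Cexp (- a))) by exact Hp.
rewrite <- !Cexp_plus. replace (- a + t) with (t - a) by ring.
transitivity ((1 - Cexp (- a)) * qpoch_inf (Cexp (a + t)) (Cexp t)
  * qpoch_inf (Cexp (t - a)) (Cexp t)); [ring|].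
replace (1 - Cexp (- a)) with (Cexp a * Cexp (- a) - Cexp (- a))
  by (now rewrite Cexp_mult_opp).
ring.
Qed.

Lemma theta_trisect (t a : C) :
  (Re t < 0)%R ->
  theta t a = theta (3 * t) a * theta (3 * t) (a + t) * theta (3 * t) (a + 2 * t).
Proof.
intros Ht. pose proof (Cmod_Cexp_lt_1 t Ht) as Hp. unfold theta.
rewrite (qpoch_inf_trisect (Cexp a)), (qpoch_inf_trisect (Cexp (t - a))) by exact Hp.
rewrite !Cexp_pow. simpl INR. rewrite !RtoC_plus. rewrite <- !Cexp_plus.
replace ((1 + 1 + 1) * t) with (3 * t) by ring.
replace (a + (1 + 1) * t) with (a + 2 * t) by ring.
replace (t - a + t) with (3 * t - (a + t)) by ring.
replace (t - a + (1 + 1) * t) with (3 * t - a) by ring.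
replace (3 * t - (a + 2 * t)) with (t - a) by ring.
ring.
Qed.

Lemma theta_cube (t a c : C) :
  (Re t < 0)%R -> Cexp c ^ 2 + Cexp c + 1 = 0 ->
  theta (3 * t) (3 * a) = theta t a * theta t (a + c) * theta t (a - c).
Proof.
intros Ht Hc. pose proof (Cmod_Cexp_lt_1 t Ht) as Hp. unfold theta.
pose proof (Cexp_opp_cube_root c Hc) as Hc3.
assert (E3 : forall x, Cexp (3 * x) = Cexp x ^ 3).
{ intros x. rewrite Cexp_pow. f_equal. simpl INR. rewrite !RtoC_plus. ring. }
replace (3 * t - 3 * a) with (3 * (t - a)) by ring.
rewrite !E3.
rewrite (qpoch_inf_cube (Cexp a) (Cexp t) (Cexp c) Hp Hc).
rewrite (qpoch_inf_cube (Cexp (t - a)) (Cexp t) (Cexp c) Hp Hc).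
rewrite <- Hc3, <- !Cexp_plus.
replace (t - (a + c)) with (t - a + - c) by ring.
replace (t - (a - c)) with (t - a + c) by ring.
replace (a - c) with (a + - c) by ring.
ring.
Qed.

Lemma qsin_theta (tau w : C) :
  let P := PI * Ci * tau in
  let z := w / PI in
  qsin tau w = Cexp (P * (z - 1 / 2) ^ 2) * theta (2 * P) (2 * P * z)
               / qpoch_inf (Cexp P) (Cexp (2 * P)) ^ 2.
Proof.
intros P z. unfold qsin, theta, qpow, nome. fold z. fold P.
rewrite Cexp_pow. replace (INR 2 * P) with (2 * P) by (simpl INR; rewrite RtoC_plus; ring).
replace (P * (2 * z)) with (2 * P * z) by ring.
replace (P * (2 - 2 * z)) with (2 * P - 2 * P * z) by ring.
easy.
Qed.

Lemma qPi_Cexp (tau : C) :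
  let P := PI * Ci * tau in
  qPi tau = Cexp (P / 4) * qpoch_inf (Cexp (2 * P)) (Cexp (2 * P)) ^ 2
            / qpoch_inf (Cexp P) (Cexp (2 * P)) ^ 2.
Proof.
intros P. unfold qPi, qpow, nome. fold P.
rewrite Cexp_pow. replace (INR 2 * P) with (2 * P) by (simpl INR; rewrite RtoC_plus; ring).
replace (P * (1 / 4)) with (P / 4) by field. easy.
Qed.

(** In base [p ^ 3] the shift by [2 * t] is a shift by [- t] followed by a full
    quasi-period, which puts the product into the symmetric form of
    [theta_determinant]. *)
Lemma theta_trisect_product (t a : C) :
  (Re t < 0)%R ->
  theta t a = - Cexp (t - a) * theta (3 * t) a
              * (theta (3 * t) (a + t) * theta (3 * t) (a - t)).
Proof.
intros Ht. rewrite theta_trisect by exact Ht.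
replace (a + 2 * t) with (a - t + 3 * t) by ring.
rewrite theta_shift by (apply Re_scal_lt_0; lra).
replace (- (a - t)) with (t - a) by ring. ring.
Qed.

Lemma theta_at_third (t : C) :
  (Re t < 0)%R ->
  theta (3 * t) t * qpoch_inf (Cexp (3 * t)) (Cexp (3 * t)) = qpoch_inf (Cexp t) (Cexp t).
Proof.
intros Ht. rewrite (qpoch_inf_trisect (Cexp t)) by now apply Cmod_Cexp_lt_1.
unfold theta. rewrite !Cexp_pow, <- !Cexp_plus. simpl INR. rewrite !RtoC_plus.
replace ((1 + 1 + 1) * t) with (3 * t) by ring.
replace (t + (1 + 1) * t) with (3 * t) by ring.
replace (3 * t - t) with (t + t) by ring.
ring.
Qed.

(** The factor 3 is [(1 - w) * (1 - w ^ 2)] for the cube root of unity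
    [w = Cexp c]; it is the source of the factor 1/3 in the final identity. *)
Lemma theta_at_cube_root (t c : C) :
  (Re t < 0)%R -> Cexp c ^ 2 + Cexp c + 1 = 0 ->
  theta t c * theta t (- c) * qpoch_inf (Cexp t) (Cexp t) ^ 2 =
    3 * qpoch_inf (Cexp (3 * t)) (Cexp (3 * t)) ^ 2.
Proof.
intros Ht Hc. pose proof (Cmod_Cexp_lt_1 t Ht) as Hp.
pose proof (Cexp_opp_cube_root c Hc) as Hc2.
assert (Hc3 : Cexp c * Cexp c ^ 2 = 1) by (rewrite <- Hc2; apply Cexp_mult_opp).
assert (E3 : Cexp (3 * t) = Cexp t ^ 3).
{ rewrite Cexp_pow. f_equal. simpl INR. rewrite !RtoC_plus. ring. }
rewrite E3, (qpoch_inf_cube (Cexp t) (Cexp t) (Cexp c) Hp Hc).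
unfold theta. replace (t - - c) with (t + c) by ring. unfold Cminus.
rewrite !Cexp_plus, Hc2.
rewrite (qpoch_inf_shift (Cexp c)), (qpoch_inf_shift (Cexp c ^ 2)) by exact Hp.
rewrite (Cmult_comm (Cexp c ^ 2) (Cexp t)), (Cmult_comm (Cexp c) (Cexp t)).
assert (E : (1 - Cexp c) * (1 - Cexp c ^ 2) = 3).
{ transitivity (1 - Cexp c - Cexp c ^ 2 + Cexp c * Cexp c ^ 2); [ring|].
  rewrite Hc3.
  transitivity (3 - (Cexp c ^ 2 + Cexp c + 1)); [ring | rewrite Hc; ring]. }
rewrite <- E. ring.
Qed.

Lemma theta_half (P : C) :
  theta (2 * P) P = qpoch_inf (Cexp P) (Cexp (2 * P)) ^ 2.
Proof. unfold theta. replace (2 * P - P) with P by ring. ring. Qed.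

(** [theta_determinant] in base [Cexp (3 * t)], with columns [t], [c], [0] and rows
    [a], [0], [3 * P]. In the row 0 the last entry vanishes with [theta] at 0, and the
    ratio of the other two fixes [A]. In the row [3 * P] each entry is computed by
    comparing two expressions of a theta function at half a quasi-period, whose
    value [theta_half] is the denominator of the corresponding q-sine. *)
Lemma theta_product_relation (P a c : C) :
  (Re P < 0)%R -> Cexp c ^ 2 + Cexp c + 1 = 0 ->
  let t := 2 * P in
  let c1 := qpoch_inf (Cexp P) (Cexp t) in
  let c3 := qpoch_inf (Cexp (3 * P)) (Cexp (3 * t)) in
  let c9 := qpoch_inf (Cexp (9 * P)) (Cexp (3 * (3 * t))) in
  let q1 := qpoch_inf (Cexp t) (Cexp t) in
  let q9 := qpoch_inf (Cexp (3 * (3 * t))) (Cexp (3 * (3 * t))) in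
  let A := Cexp (- t) * (q1 ^ 2 * c9 ^ 2) / (3 * (q9 ^ 2 * c1 ^ 2)) in
  c1 <> 0 /\ c3 <> 0 /\ c9 <> 0 /\ q9 <> 0 /\
  theta (3 * t) (a + t) * theta (3 * t) (a - t) / c1 ^ 2 =
    (1 + A) * (theta (3 * t) a ^ 2 / c3 ^ 6)
    - A * (theta (3 * t) (a + c) * theta (3 * t) (a - c) / c9 ^ 2).
Proof.
intros HP Hc t c1 c3 c9 q1 q9 A.
assert (Ht : (Re t < 0)%R) by (apply Re_scal_lt_0; lra).
assert (H3t : (Re (3 * t) < 0)%R) by (apply Re_scal_lt_0; lra).
assert (H9t : (Re (3 * (3 * t)) < 0)%R) by (apply Re_scal_lt_0; lra).
set (q3 := qpoch_inf (Cexp (3 * t)) (Cexp (3 * t))).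
assert (N : forall x l : C, (Re x < 0)%R -> (Re l < 0)%R ->
            qpoch_inf (Cexp x) (Cexp l) <> 0).
{ intros x l Hx Hl. now apply qpoch_inf_neq_0_lt_1; apply Cmod_Cexp_lt_1. }
assert (N1 : c1 <> 0) by now apply N.
assert (N3 : c3 <> 0) by (apply N; [apply Re_scal_lt_0; lra | exact H3t]).
assert (N9 : c9 <> 0) by (apply N; [apply Re_scal_lt_0; lra | exact H9t]).
assert (M3 : q3 <> 0) by now apply N.
assert (M9 : q9 <> 0) by now apply N.
repeat split; auto.
(* Entries of the row [3 * P]. *)
assert (V1 : theta t P = c1 ^ 2) by apply theta_half.
assert (V3 : theta (3 * t) (3 * P) = c3 ^ 2).
{ unfold c3. replace (3 * t) with (2 * (3 * P)) by (unfold t; ring). apply theta_half. }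
assert (V9 : theta (3 * (3 * t)) (3 * (3 * P)) = c9 ^ 2).
{ unfold c9. replace (3 * (3 * t)) with (2 * (9 * P)) by (unfold t; ring).
  replace (3 * (3 * P)) with (9 * P) by ring. apply theta_half. }
assert (K1 : theta (3 * t) (3 * P + t) * theta (3 * t) (3 * P - t) = c1 ^ 2 / c3 ^ 2).
{ pose proof (theta_trisect_product t (3 * P) Ht) as S1.
  (* [3 * P] is half a quasi-period of [theta (3 * t)], but [P + t] for [theta t]. *)
  replace (theta t (3 * P)) with (- Cexp (- P) * theta t P) in S1
    by (rewrite <- theta_shift by exact Ht; f_equal; unfold t; ring).
  replace (t - 3 * P) with (- P) in S1 by (unfold t; ring).
  rewrite V1, V3 in S1. pose proof (Cexp_neq_0 (- P)) as Ne.
  apply (Cmult_eq_reg_l (- Cexp (- P) * c3 ^ 2)).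
  - apply Cmult_neq_0; [|now apply Cpow_nz].
    intros E. apply Ne. rewrite <- Copp_0, <- E. ring.
  - rewrite <- S1. field. exact N3. }
assert (K9 : theta (3 * t) (3 * P + c) * theta (3 * t) (3 * P - c) = c9 ^ 2 / c3 ^ 2).
{ pose proof (theta_cube (3 * t) (3 * P) c H3t Hc) as S9.
  rewrite V3, V9, <- Cmult_assoc in S9. rewrite S9. field. exact N3. }
(* Entries of the row 0. *)
assert (T1 : theta (3 * t) t * theta (3 * t) (- t) = - Cexp (- t) * (q1 ^ 2 / q3 ^ 2)).
{ assert (T : theta (3 * t) t = q1 / q3).
  { unfold q1. rewrite <- theta_at_third by exact Ht. fold q3. field. exact M3. }
  (* Reflection sends [t] to [2 * t], which is congruent to [- t] modulo [3 * t]. *)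
  assert (Tm : theta (3 * t) (- t) = - Cexp (- t) * theta (3 * t) t).
  { rewrite <- (theta_sym (3 * t) t). replace (3 * t - t) with (- t + 3 * t) by ring.
    rewrite theta_shift by exact H3t. replace (- - t) with t by ring.
    transitivity (Cexp t * Cexp (- t) * theta (3 * t) (- t)); [|ring].
    rewrite Cexp_mult_opp. ring. }
  rewrite Tm, T. field. exact M3. }
assert (T9 : theta (3 * t) c * theta (3 * t) (- c) = 3 * q9 ^ 2 / q3 ^ 2).
{ unfold q9. rewrite <- theta_at_cube_root with (c := c) by assumption.
  fold q3. field. exact M3. }
pose proof (theta_determinant (3 * t) a 0 (3 * P) t c 0 H3t) as D. cbv beta zeta in D.
assert (Sub0 : forall y, 0 - y = - y) by (intros; ring).
assert (Zer : forall y, y - 0 = y) by (intros; ring).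
rewrite !Cplus_0_l, !Cplus_0_r, !Zer, !Sub0, T1, T9, K1, K9, theta_0, V3 in D by exact H3t.
set (H1 := theta (3 * t) (a + t) * theta (3 * t) (a - t)) in *.
set (H9 := theta (3 * t) (a + c) * theta (3 * t) (a - c)) in *.
set (Th := theta (3 * t) a) in *.
apply (proj2 (Ceq_minus _ _)). apply (Cmult_eq_reg_l (3 * q9 ^ 2 * c3 ^ 4 * c1 ^ 2)).
- repeat (apply Cmult_neq_0; [|now apply Cpow_nz]).
  intros E. apply RtoC_inj in E. lra.
- rewrite Cmult_0_r, <- (Cmult_0_r (q3 ^ 2)), <- D. unfold A. field. auto.
Qed.

Theorem corollary2 (tau : C) (htau : (0 < Im tau)%R) (z : C) :
  qsin tau (3 * z) =
    1 / 3 * (qPi tau / qPi (9 * tau)) * qsin (9 * tau) z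
    - (1 + 1 / 3 * (qPi tau / qPi (9 * tau))) * qsin (3 * tau) z ^ 3.
Proof.
rewrite !qsin_theta, !qPi_Cexp.
set (P := PI * Ci * tau).
replace (PI * Ci * (9 * tau)) with (9 * P) by (unfold P; ring).
replace (PI * Ci * (3 * tau)) with (3 * P) by (unfold P; ring).
assert (HPI : RtoC PI <> 0) by (intros E; apply RtoC_inj in E; now apply PI_neq0).
replace (3 * z / PI) with (3 * (z / PI)) by (field; exact HPI).
set (x := z / PI).
assert (HP : (Re P < 0)%R).
{ unfold P. replace (PI * Ci * tau) with (PI * (tau * Ci)) by ring.
  rewrite re_scal_l, re_mult_Ci. pose proof PI_RGT_0. nra. }
replace (2 * (3 * P)) with (3 * (2 * P)) by ring.
replace (2 * (9 * P)) with (3 * (3 * (2 * P))) by ring.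
destruct cube_root_of_unity as [c Hc].
destruct (theta_product_relation P (3 * (2 * P) * x) c HP Hc)
  as [N1 [N3 [N9 [M9 R]]]]. cbv zeta in R.
set (t := 2 * P) in *. set (a := 3 * t * x) in *.
replace (t * (3 * x)) with a by (unfold a; ring).
replace (3 * (3 * t) * x) with (3 * a) by (unfold a; ring).
assert (Ht : (Re t < 0)%R) by (apply Re_scal_lt_0; lra).
assert (H3t : (Re (3 * t) < 0)%R) by (apply Re_scal_lt_0; lra).
rewrite (theta_trisect_product t a Ht), (theta_cube (3 * t) a c H3t Hc).
set (E := Cexp (9 * P * (x - 1 / 2) ^ 2)).
(* The three exponential prefactors agree, up to the quasi-periodicity factor
   [Cexp (t - a)] that comes with [sin_q (3 z)]. *)
assert (E1 : Cexp (P * (3 * x - 1 / 2) ^ 2) * Cexp (t - a) = E).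
{ unfold E. rewrite <- Cexp_plus. f_equal. unfold a, t. field. }
assert (E3 : Cexp (3 * P * (x - 1 / 2) ^ 2) ^ 3 = E).
{ unfold E. rewrite Cexp_pow. f_equal. simpl INR. rewrite !RtoC_plus. field. }
assert (Eq : Cexp (P / 4) = Cexp (- t) * Cexp (9 * P / 4)).
{ rewrite <- Cexp_plus. f_equal. unfold t. field. }
rewrite Eq. pose proof (Cexp_neq_0 (9 * P / 4)) as Ne.
transitivity (- E * theta (3 * t) a
  * (theta (3 * t) (a + t) * theta (3 * t) (a - t)
     / qpoch_inf (Cexp P) (Cexp t) ^ 2)).
{ rewrite <- E1. field. exact N1. }
rewrite R, <- E3. field. repeat split; assumption.
Qed.
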